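(* Let $q$ be a prime power, and suppose there exists a Hadamard matrix $H$ of order $q+1$ with an all-ones row. Let $H_-$ denote the $q\times(q+1)$ submatrix of $H$ obtained by removing this all-ones row. Let $\mathbf{P}_q$ and $\mathbf{A}_q$ denote the projective and affine planes of order $q$, respectively, and let $\mathbf{A}_q^*$ be the dual structure of $\mathbf{A}_q$. Consider each of the following four pairs $(C,V)$ of an incidence structure $C=(P,L,I)$ and a vector ensemble $V=\{v_j\}_{j\in J}$ (the columns of the indicated matrix): \[ (\mathbf{P}_q,H),\qquad(\mathbf{P}_q,H_-^\top),\qquad(\mathbf{A}_q,H_-),\qquad(\mathbf{A}_q^*,H). \] For each of these pairs: (i) there exist super embeddings $\{E_l\}_{l\in L}$ such that $\{E_lv_j\}_{l\in L,\,j\in J}$ is an orthobiangular tight frame for its span; (ii) the coherence of this frame is $1+o(1)$ times Welch's lower bound $\sqrt{\frac{n-d}{d(n-1)}}$, where $n=|L||J|$ is the number of vectors, $d$ is the dimension of their span, and $o(1)$ is as $q\to\infty$; and (iii) there is no orthobiangular tight frame of the same size $n$ in the same space (i.e., in dimension $d$) with smaller coherence.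
   Context: A Hadamard matrix of order $N$ is an $N\times N$ matrix with entries $\pm1$ and pairwise orthogonal rows. An incidence structure is a triple $C=(P,L,I)$ with finite sets $P$ of points and $L$ of lines and an incidence relation $I\subseteq P\times L$; $(p,l)\in I$ means that $p$ lies on $l$, and each line $l$ is identified with the set of points on it, so $|l|$ is the number of points on $l$. The dual structure of $C$ is $C^*=(L,P,I^* )$ with $I^*=\{(l,p):(p,l)\in I\}$. The projective plane $\mathbf{P}_q$ of order $q$ has $q^2+q+1$ points and $q^2+q+1$ lines, each line with $q+1$ points, any two distinct points on a unique line and any two distinct lines meeting in exactly one point; the affine plane $\mathbf{A}_q$ of order $q$ has $q^2$ points and $q^2+q$ lines, each line with $q$ points, any two distinct points on a unique line (for $q$ a prime power these are the planes over $\mathbb{F}_q$). $\mathbb{R}^P$ is the space of real-valued functions on $P$, and $\mathbb{R}^l\subseteq\mathbb{R}^P$ is the subspace of functions supported on $l$. A super embedding for $l\in L$ is a linear map $E_l\colon\mathbb{R}^{|l|}\to\mathbb{R}^l\subseteq\mathbb{R}^P$ such that $\|E_lz\|_p=\|z\|_p$ for every $z\in\mathbb{R}^{|l|}$ and every $p\in[1,\infty]$. A finite sequence $\{\varphi_i\}_{i=1}^n$ of vectors in a $d$-dimensional real inner product space is a tight frame for that space if there is $a>0$ with $\sum_i|\langle x,\varphi_i\rangle|^2=a\|x\|^2$ for all $x$ in the space. A sequence of vectors all having the same nonzero norm is orthobiangular if there is $\beta\ge0$ such that $\langle\varphi_i,\varphi_j\rangle\in\{0,\beta,-\beta\}$ for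 all $i\ne j$. The coherence of an equal-norm sequence is the maximum of $|\langle\varphi_i,\varphi_j\rangle|/(\|\varphi_i\|\|\varphi_j\|)$ over $i\ne j$ (i.e., the coherence after normalizing to unit vectors). *)

(* Defs.v *)
From HB Require Import structures.
From mathcomp Require Import all_boot all_order all_algebra.
From mathcomp Require Import all_classical all_reals all_analysis.

Set Implicit Arguments.
Unset Strict Implicit.
Unset Printing Implicit Defensive.

Import Order.TTheory GRing.Theory Num.Theory.
Import numFieldNormedType.Exports.

Local Open Scope ring_scope.

Definition prime_power (q : nat) : Prop :=
  exists p k : nat, [/\ prime p, (0 < k)%N & q = (p ^ k)%N].

Record incidence := Incidence {
  point : finType;
  line : finType;
  inc : point -> line -> bool }.

Definition on_line (C : incidence) (l : line C) : {set point C} :=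
  [set x | inc x l].

Definition dual (C : incidence) : incidence :=
  Incidence (fun (l : line C) (x : point C) => inc x l).

Definition projective_plane (q : nat) (C : incidence) : Prop :=
  [/\ #|point C| = (q ^ 2 + q + 1)%N,
      #|line C| = (q ^ 2 + q + 1)%N,
      forall l : line C, #|on_line l| = q.+1,
      forall x y : point C, x <> y -> exists! l : line C, inc x l /\ inc y l
    & forall l m : line C, l <> m -> exists! x : point C, inc x l /\ inc x m].

Definition affine_plane (q : nat) (C : incidence) : Prop :=
  [/\ #|point C| = (q ^ 2)%N,
      #|line C| = (q ^ 2 + q)%N,
      forall l : line C, #|on_line l| = q
    & forall x y : point C, x <> y -> exists! l : line C, inc x l /\ inc y l].

Definition hadamard (R : realType) (N : nat) (H : 'M[R]_N) : Prop :=
  (forall i j, H i j = 1 \/ H i j = -1) /\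
  (forall i i', i != i' -> \sum_j H i j * H i' j = 0).

(* The real vector space of functions T -> R; R^k is [fvec R 'I_k]. *)
Notation fvec R T := {ffun T -> R^o}.

Definition colv (R : realType) (k m : nat) (V : 'M[R]_(k, m)) (j : 'I_m) :
  fvec R 'I_k := [ffun i => V i j].

Definition dotp (R : realType) (T : finType) (x y : fvec R T) : R :=
  \sum_t (x t : R) * (y t : R).

Definition enorm (R : realType) (T : finType) (x : fvec R T) : R :=
  Num.sqrt (dotp x x).

(* Only used for 1 <= p; the second branch is then the case p = +oo. *)
Definition lpnorm (R : realType) (T : finType) (p : \bar R) (x : fvec R T) : R :=
  match p with
  | r%:E%E => (\sum_t `|x t : R| `^ r) `^ r^-1
  | _ => \big[Num.max/0]_t `|x t : R|
  end.

(* The domain is R^k together with the requirement |l| = k, rather than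
   R^|l|, so that no cast is needed to apply E to vectors of R^k. *)
Definition super_embedding (R : realType) (C : incidence) (k : nat)
    (l : line C) (E : {linear fvec R 'I_k -> fvec R (point C)}) : Prop :=
  [/\ #|on_line l| = k,
      forall z x, x \notin on_line l -> E z x = 0
    & forall (z : fvec R 'I_k) (p : \bar R),
        (1%:E <= p)%E -> lpnorm p (E z) = lpnorm p z].

Definition lifted (R : realType) (C : incidence) (k m : nat)
    (E : line C -> {linear fvec R 'I_k -> fvec R (point C)})
    (V : 'M[R]_(k, m)) (lj : line C * 'I_m) : fvec R (point C) :=
  E lj.1 (colv V lj.2).

Definition tight_frame (R : realType) (T K : finType)
    (W : {vspace fvec R T}) (phi : K -> fvec R T) : Prop :=
  (forall i, phi i \in W) /\
  exists2 a : R, 0 < a &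
    forall x, x \in W -> \sum_i `|dotp x (phi i)| ^+ 2 = a * enorm x ^+ 2.

Definition orthobiangular (R : realType) (T K : finType)
    (phi : K -> fvec R T) : Prop :=
  (exists2 r : R, r != 0 & forall i, enorm (phi i) = r) /\
  exists2 beta : R, 0 <= beta &
    forall i j, i != j ->
      [\/ dotp (phi i) (phi j) = 0, dotp (phi i) (phi j) = beta
        | dotp (phi i) (phi j) = - beta].

Definition ob_tight_frame (R : realType) (T K : finType)
    (W : {vspace fvec R T}) (phi : K -> fvec R T) : Prop :=
  tight_frame W phi /\ orthobiangular phi.

Definition fspan (R : realType) (T K : finType) (phi : K -> fvec R T) :
  {vspace fvec R T} := <<codom phi>>%VS.

Definition coherence (R : realType) (T K : finType) (phi : K -> fvec R T) : R :=
  \big[Num.max/0]_(ij : K * K | ij.1 != ij.2)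
    (`|dotp (phi ij.1) (phi ij.2)| / (enorm (phi ij.1) * enorm (phi ij.2))).

Definition welch (R : realType) (n d : nat) : R :=
  Num.sqrt ((n%:R - d%:R) / (d%:R * (n%:R - 1))).

Definition lift_obtf (R : realType) (C : incidence) (k m : nat)
    (V : 'M[R]_(k, m))
    (E : line C -> {linear fvec R 'I_k -> fvec R (point C)}) : Prop :=
  (forall l, super_embedding l (E l)) /\
  ob_tight_frame (fspan (lifted E V)) (lifted E V).

Definition near_welch (R : realType) (T K : finType) (e : R)
    (phi : K -> fvec R T) : Prop :=
  let w := welch R #|K| (\dim (fspan phi)) in
  `|coherence phi - w| <= e * w.

Definition least_coherent (R : realType) (T K : finType)
    (phi : K -> fvec R T) : Prop :=
  forall (T' K' : finType) (W : {vspace fvec R T'}) (psi : K' -> fvec R T'),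
    #|K'| = #|K| -> \dim W = \dim (fspan phi) -> ob_tight_frame W psi ->
    ~ (coherence psi < coherence phi).

(* [e] bounds the relative deviation from the Welch bound. *)
Definition optimal_pair (R : realType) (e : R) (C : incidence) (k m : nat)
    (V : 'M[R]_(k, m)) : Prop :=
  (exists E : line C -> {linear fvec R 'I_k -> fvec R (point C)},
     lift_obtf V E) /\
  (forall E : line C -> {linear fvec R 'I_k -> fvec R (point C)},
     lift_obtf V E ->
     near_welch e (lifted E V) /\ least_coherent (lifted E V)).

(* Main.v *)
From HB Require Import structures.
From mathcomp Require Import all_boot all_order all_algebra.
From mathcomp Require Import all_classical all_reals all_analysis.
From mathcomp Require Import ring lra zify.
Require Import Defs.

Set Implicit Arguments.
Unset Strict Implicit.
Unset Printing Implicit Defensive.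

Import Order.TTheory GRing.Theory Num.Theory.
Import numFieldNormedType.Exports.

(** A super embedding is an isometry and sends a vector of signs to a vector
    of signs on its line.  In each of the four incidence structures every line
    has [k] points, every point lies on [r] lines, and two lines share at most
    one point; the vectors [v_j] have [k] entries [1] or [-1], and all their
    mutual inner products have the same square [delta], which is [0] or [1].
    Hence, whatever the super embeddings are, the lifted vectors have squared
    norm [k], two lifts to distinct lines have inner product [0] if the
    lines are disjoint and [1] or [-1] if they meet, and the coherence is
    [1 / k] ([lifted_coherence]).

    Counting the meeting lines, every row of the Gram matrix has the sum of
    squares [f = k^2 + (m - 1) delta + k (r - 1) m], where [m] is the number of
    the [v_j] ([lifted_frame_row]).  In a tight frame with frame constant [a]
    spanning dimension [d], a row sum is [a k], and the trace of the frame
    operator is [n k = a d] ([tight_trace]).  So tightness alone fixes the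
    dimension, [d f = n k^2] ([lifted_dim]), and with it the Welch bound.

    For existence, number the points of each line and extend vectors by zero.
    If the [v_j] satisfy Parseval's identity up to a constant then so do their
    lifts ([tight_parseval]).  For the transpose of the truncated Hadamard
    matrix, Parseval fails by the square of the sum of the entries; summed over
    the lines of a projective plane this defect is a multiple of the squared
    norm plus the square of the total sum, and the total sum vanishes on the
    span ([tight_simplex]).

    For optimality, take any orthobiangular tight frame of [n] vectors in
    dimension [d], with squared norm [N] and inner products [0], [beta],
    [- beta].  Its Gram matrix is [G = N + beta S] with [S] an integer matrix,
    and [G^2 = a G] says that [S] satisfies a monic quadratic equation
    [X^2 - c X - b = 0] with integer coefficients, of which [- N / beta] is a
    root.  When [n <> 2 d] this root is rational, so [N / beta], the inverse of
    the coherence, is an integer ([norm_over_beta_integral]).  The Welch bound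
    says [(N / beta)^2 (n - d) <= d (n - 1)].  In the four cases the square root
    of [d (n - 1) / (n - d)] is at least [k] and less than
    [k + 1], so [N / beta <= k]
    and no such frame has coherence below [1 / k]
    ([obtf_coherence_bound]).

    With [v = q^2 + q + 1], the parameters [(n, d, k)] are
    [((q + 1) v, v, q + 1)], [(q v, q (q + 1), q + 1)],
    [(q (q + 1)^2, q^2, q)] and [(q^2 (q + 1), q (q + 1), q + 1)].  In each case
    [d (n - 1) / (n - d)] is at most [(1 + 1 / q) k^2], so the coherence exceeds
    the Welch bound by a factor of at most [1 + 1 / q].  Only the last case can
    have [n = 2 d], namely for [q = 2], and there is no Hadamard matrix of
    order three. *)

Local Open Scope ring_scope.

(** * The inner product *)

Section Inner.
Variables (R : realType) (T : finType).
Implicit Types x y z : fvec R T.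

Lemma dotpC x y : dotp x y = dotp y x.
Proof. by apply: eq_bigr => t _; rewrite mulrC. Qed.

Lemma dotpDl x y z : dotp (x + y) z = dotp x z + dotp y z.
Proof. by rewrite -big_split; apply: eq_bigr => t _; rewrite ffunE mulrDl. Qed.

Lemma dotpDr x y z : dotp z (x + y) = dotp z x + dotp z y.
Proof. by rewrite !(dotpC z) dotpDl. Qed.

Lemma dotpZl (c : R) x y : dotp (c *: x) y = c * dotp x y.
Proof. by rewrite mulr_sumr; apply: eq_bigr => t _; rewrite ffunE mulrA. Qed.

Lemma dotp_suml (K : finType) (F : K -> fvec R T) y :
  dotp (\sum_j F j) y = \sum_j dotp (F j) y.
Proof.
rewrite exchange_big; apply: eq_bigr => t _.
by rewrite sum_ffunE mulr_suml.
Qed.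

Lemma dotp_ge0 x : 0 <= dotp x x.
Proof. by apply: sumr_ge0 => t _; rewrite -expr2 sqr_ge0. Qed.

Lemma enorm_sqr x : enorm x ^+ 2 = dotp x x.
Proof. by rewrite sqr_sqrtr ?dotp_ge0. Qed.

Lemma dotp_eq0 x : dotp x x = 0 -> x = 0.
Proof.
move=> /psumr_eq0P h; apply/ffunP => t; rewrite ffunE.
apply/eqP; rewrite -sqrf_eq0 expr2; apply/eqP/h => // s _.
by rewrite -expr2 sqr_ge0.
Qed.

Lemma dotp_sqrD x y :
  dotp (x + y) (x + y) = dotp x x + 2 * dotp x y + dotp y y.
Proof. rewrite dotpDl !dotpDr (dotpC y x); ring. Qed.

End Inner.

(** * Tight frames *)

Section Tight.
Variables (R : realType) (T K : finType) (W : {vspace fvec R T}).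
Variables (psi : K -> fvec R T) (a : R).
Hypothesis psiW : forall i, psi i \in W.
Hypothesis tight : forall x, x \in W ->
  \sum_i `|dotp x (psi i)| ^+ 2 = a * enorm x ^+ 2.

Lemma tight_polar x y : x \in W -> y \in W ->
  \sum_i dotp x (psi i) * dotp y (psi i) = a * dotp x y.
Proof.
have sq z : z \in W -> \sum_i dotp z (psi i) ^+ 2 = a * dotp z z.
  move=> /tight; rewrite enorm_sqr => <-.
  by apply: eq_bigr => i _; rewrite real_normK ?num_real.
move=> xW yW; have := sq _ (rpredD xW yW); rewrite dotp_sqrD.
under eq_bigr => i _ do rewrite dotpDl sqrrD.
rewrite !big_split /= !sq //; lra.
Qed.

(** The difference of the two sides lies in [W] and is orthogonal to [W]. *)
Lemma tight_reconstruct x : x \in W -> \sum_i dotp x (psi i) *: psi i = a *: x.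
Proof.
move=> xW; apply/eqP; rewrite -subr_eq0; apply/eqP.
set y := _ - _.
have yW : y \in W.
  by rewrite rpredB ?rpredZ // rpred_sum // => i _; rewrite rpredZ.
apply: dotp_eq0; rewrite {1}/y -scaleNr dotpDl dotp_suml dotpZl.
rewrite mulNr -tight_polar //; apply/eqP; rewrite subr_eq0; apply/eqP.
by apply: eq_bigr => i _; rewrite dotpZl (dotpC y).
Qed.

(** The frame operator is [a] times the identity of [W]; both sides are its
    trace, computed on the right in a basis of [W] and its coordinate forms. *)
Lemma tight_trace : \sum_i dotp (psi i) (psi i) = a * (\dim W)%:R.
Proof.
pose e := vbasis W.
have eW k : e`_k \in W.
  have [kd|kd] := ltnP k (size e); first exact/vbasis_mem/mem_nth.
  by rewrite nth_default ?rpred0.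
transitivity (\sum_(k < \dim W) coord e k (a *: e`_k)); last first.
  under eq_bigr => k _.
    rewrite linearZ /= coord_free ?(basis_free (vbasisP W)) // eqxx mulr1.
    over.
  by rewrite sumr_const card_ord mulr_natr.
transitivity (\sum_(k < \dim W) \sum_i dotp e`_k (psi i) * coord e k (psi i)).
  rewrite [RHS]exchange_big; apply: eq_bigr => i _.
  rewrite {1}(coord_vbasis (psiW i)) dotp_suml.
  by apply: eq_bigr => k _; rewrite dotpZl mulrC.
apply: eq_bigr => k _; rewrite -tight_reconstruct // linear_sum.
by apply: eq_bigr => i _; rewrite linearZ.
Qed.
End Tight.

(** * A lower bound for the coherence of orthobiangular tight frames *)

(** A rational number that is integral over the integers is an integer: its
    denominator divides the square of its numerator. *)
Lemma int_of_quadratic (R : realType) (x : R) (c m u w : int) :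
  u != 0 -> u%:~R * x = w%:~R -> x ^+ 2 + c%:~R * x = m%:~R ->
  exists z : int, x = z%:~R.
Proof.
move=> u0 ux; pose y : rat := w%:~R / u%:~R.
have uR : u%:~R != 0 :> R by rewrite intr_eq0.
have -> : x = ratr y.
  rewrite /y fmorph_div /= !ratr_int; apply: (mulfI uR).
  by rewrite ux mulrCA divff // mulr1.
(* Rewriting with [rmorphM] would otherwise unfold [y] as a product. *)
move=> e; clearbody y; have {e} e : y ^+ 2 + c%:~R * y = m%:~R.
  apply: (fmorph_inj (@ratr R)).
  by rewrite rmorphD rmorphXn rmorphM /= !ratr_int.
exists (numq y).
suff d1 : denq y = 1 by rewrite -{1}[y]divq_num_den d1 divr1 ratr_int.
have {e} e : numq y ^+ 2 = (m * denq y - c * numq y) * denq y.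
  apply: (intr_inj (R := rat)).
  rewrite rmorphXn rmorphM rmorphB !rmorphM /= -e numqE; ring.
have dvd : (denq y %| numq y ^+ 2)%Z by rewrite e dvdz_mull.
have cop : coprimez (denq y) (numq y ^+ 2).
  by rewrite coprimezXr // coprimez_sym; apply: coprime_num_den.
move: dvd; rewrite -[numq y ^+ 2]mulr1 Gauss_dvdzr // dvdz1 => /eqP d1.
by rewrite -[denq y]gtz0_abs // d1.
Qed.

Lemma ge_coherence (R : realType) (T K : finType) (psi : K -> fvec R T) i j :
  i != j ->
  `|dotp (psi i) (psi j)| / (enorm (psi i) * enorm (psi j)) <= coherence psi.
Proof.
move=> ij; pose F (p : K * K) :=
  `|dotp (psi p.1) (psi p.2)| / (enorm (psi p.1) * enorm (psi p.2)).
exact: (@le_bigmax_cond _ _ _ 0 (i, j) (fun p : K * K => p.1 != p.2) F).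
Qed.

Section Integrality.
Variables (R : realType) (T K : finType) (W : {vspace fvec R T}).
Variables (psi : K -> fvec R T) (a N beta : R).
Let n := #|K|.
Let d := \dim W.
Hypothesis psiW : forall i, psi i \in W.
Hypothesis tight : forall x, x \in W ->
  \sum_i `|dotp x (psi i)| ^+ 2 = a * enorm x ^+ 2.
Hypothesis N_gt0 : 0 < N.
Hypothesis psiN : forall i, dotp (psi i) (psi i) = N.
Hypothesis psi_beta : forall i j, i != j ->
  [\/ dotp (psi i) (psi j) = 0, dotp (psi i) (psi j) = beta
    | dotp (psi i) (psi j) = - beta].

Let sgn i j : int := sgz (dotp (psi i) (psi j)).

Hypothesis beta_ge0 : 0 <= beta.

Lemma signed_gram i j : i != j ->
  dotp (psi i) (psi j) = beta * (sgn i j)%:~R.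
Proof.
rewrite /sgn => /psi_beta; case: (ltgtP 0 beta) beta_ge0 => // [b0|<-] _.
  case=> ->; first by rewrite sgz0 mulr0.
    by rewrite gtr0_sgz ?mulr1.
  by rewrite ltr0_sgz ?oppr_lt0 ?mulrN1.
by rewrite mul0r oppr0; case.
Qed.

Lemma sgn_sqr i j : sgn i j ^+ 2 = (dotp (psi i) (psi j) != 0)%:Z.
Proof. by rewrite /sgn /sgz; case: eqP => //; case: ifP. Qed.

Hypotheses (n2d : n != (2 * d)%N) (dn : (d < n)%N).

Lemma frame_constant_dim : n%:R * N = a * d%:R.
Proof.
rewrite -(tight_trace psiW tight) (eq_bigr (fun=> N)) //.
by rewrite sumr_const mulr_natl.
Qed.

Lemma dim_obtf_gt0 : (0 < d)%N.
Proof.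
rewrite lt0n; apply/eqP => d0; have := frame_constant_dim.
rewrite d0 mulr0 => /eqP; rewrite mulf_eq0 (gt_eqF N_gt0) orbF pnatr_eq0.
by move=> /eqP n0; move: dn; rewrite n0.
Qed.

(** The matrix identity [G^2 = a G] for the Gram matrix [G]. *)
Lemma gram_sqr i k :
  \sum_j dotp (psi i) (psi j) * dotp (psi k) (psi j) = a * dotp (psi i) (psi k).
Proof. exact: (tight_polar tight). Qed.

Lemma frame_constant_neq_norm : a != N.
Proof.
apply/eqP => aN; have := frame_constant_dim.
rewrite aN mulrC => /(mulfI (lt0r_neq0 N_gt0)).
by move=> /(mulrIn (oner_neq0 R)) nd; move: dn; rewrite nd ltnn.
Qed.

(** Otherwise the frame would be an orthogonal basis, contrary to [d < n]. *)
Lemma obtf_nonorthogonal : exists i j, i != j /\ dotp (psi i) (psi j) != 0.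
Proof.
have /card_gt0P[i _] : (0 < #|K|)%N by apply: leq_ltn_trans dn.
apply: contrapT => hno; move: frame_constant_neq_norm => /eqP; apply.
have := gram_sqr i i; rewrite (bigD1 i) //= big1 ?addr0 ?psiN => [|j ji].
  by move=> /(mulIf (lt0r_neq0 N_gt0)).
suff -> : dotp (psi i) (psi j) = 0 by rewrite mul0r.
apply: contrapT => /eqP h; apply: hno; exists i, j; split=> //.
by rewrite eq_sym.
Qed.

(** Let [G = N + beta S].  The diagonal entry [(i, i)] of [G^2 = a G] gives an
    integer [m], at most [n - 1], with [beta^2 m = N (a - N)], and an entry
    [(i, k)] with [S i k <> 0] gives an integer [c] with
    [beta c = a - 2 N].  Then [x = N / beta] satisfies [x^2 + c x = m].
    Eliminating [a] with [n N = a d] gives [c (n - d) x = m (n - 2 d)]; here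
    [c <> 0] as [n <> 2 d], so [x] is rational, hence an integer.  Eliminating
    [a] from [beta^2 m = N (a - N)] instead gives [x^2 (n - d) = d m], and
    [m <= n - 1]. *)
Lemma norm_over_beta_integral : exists2 z : int, N = beta * z%:~R &
  z%:~R ^+ 2 * (n%:R - d%:R) <= d%:R * (n%:R - 1) :> R.
Proof.
have [i [k [ik g0]]] := obtf_nonorthogonal.
have beta0 : beta != 0.
  by apply: contraNneq g0; rewrite signed_gram // => ->; rewrite mul0r.
pose m : int := \sum_(j | j != i) sgn i j ^+ 2.
pose t : int := \sum_(j | (j != i) && (j != k)) sgn i j * sgn k j.
pose c : int := sgn i k * t.
have hm : N ^+ 2 + beta ^+ 2 * m%:~R = a * N.
  rewrite -{2}(psiN i) -gram_sqr (bigD1 i) //= psiN -expr2; congr (_ + _).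
  rewrite rmorph_sum mulr_sumr; apply: eq_bigr => j ji.
  by rewrite signed_gram 1?eq_sym // rmorphXn /=; ring.
have s1 : (sgn i k)%:~R ^+ 2 = 1 :> R.
  by rewrite -rmorphXn /= sgn_sqr g0.
have hc : beta * c%:~R = a - 2 * N.
  have /eqP := gram_sqr i k; rewrite (bigD1 i) //= (bigD1 k) 1?eq_sym //= !psiN.
  rewrite (dotpC (psi k)) !signed_gram //.
  rewrite (_ : \sum_(j | _) _ = beta ^+ 2 * t%:~R); last first.
    rewrite rmorph_sum mulr_sumr; apply: eq_bigr => j /andP[ji jk].
    by rewrite !signed_gram 1?eq_sym // rmorphM /=; ring.
  move=> /eqP e; apply: (mulfI beta0).
  rewrite rmorphM /=; set s := (sgn i k)%:~R in s1 e *.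
  have e' : beta ^+ 2 * t%:~R = (a - 2 * N) * beta * s by lra.
  have -> : beta * (beta * (s * t%:~R)) = s * (beta ^+ 2 * t%:~R) by ring.
  rewrite e'; transitivity (beta * (a - 2 * N) * s ^+ 2); first by ring.
  by rewrite s1 mulr1.
have had := frame_constant_dim.
have d0 : d%:R != 0 :> R by rewrite pnatr_eq0 -lt0n dim_obtf_gt0.
have c0 : c != 0.
  apply: contra_neq n2d => c0; move: hc; rewrite c0 mulr0 => /esym/eqP.
  rewrite subr_eq0 => /eqP aE; move: had.
  rewrite aE mulrAC => /(mulIf (lt0r_neq0 N_gt0)).
  by rewrite -natrM => /eqP; rewrite eqr_nat => /eqP.
have hdm : N ^+ 2 * (n%:R - d%:R) = beta ^+ 2 * m%:~R * d%:R.
  have -> : beta ^+ 2 * m%:~R = a * N - N ^+ 2 by rewrite -hm; ring.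
  have -> : (a * N - N ^+ 2) * d%:R = N * (a * d%:R) - N ^+ 2 * d%:R by ring.
  rewrite -had; ring.
(* As above, [c] must not be seen as a product. *)
clearbody c; pose x := N / beta.
have Nx : N = beta * x by rewrite /x mulrCA divff // mulr1.
have [z xz] : exists z : int, x = z%:~R.
  apply: (@int_of_quadratic _ x c m (c * (n%:Z - d%:Z))
    (m * (n%:Z - (2 * d)%:Z))).
  - by rewrite mulf_neq0 // subr_eq0 eqz_nat gtn_eqF.
  - apply: (mulfI (expf_neq0 2 beta0)); apply: (mulfI d0).
    rewrite !rmorphM !rmorphB /= PoszM !rmorphM /= -!pmulrn.
    have -> : d%:R * (beta ^+ 2 * (c%:~R * (n%:R - d%:R) * x)) =
      (beta * c%:~R) * (beta * x) * d%:R * (n%:R - d%:R) by ring.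
    have -> : d%:R * (beta ^+ 2 * (m%:~R * (n%:R - 2 * d%:R))) =
      beta ^+ 2 * m%:~R * d%:R * (n%:R - 2 * d%:R) by ring.
    rewrite -hdm hc -Nx.
    transitivity ((a * d%:R - 2 * N * d%:R) * N * (n%:R - d%:R)); first by ring.
    by rewrite -had; ring.
  - apply: (mulfI (expf_neq0 2 beta0)).
    have -> : beta ^+ 2 * m%:~R = a * N - N ^+ 2 by rewrite -hm; ring.
    rewrite mulrDr -exprMn -Nx.
    have -> : beta ^+ 2 * (c%:~R * x) = (beta * c%:~R) * (beta * x) by ring.
    by rewrite hc -Nx; ring.
exists z; first by rewrite -xz.
rewrite -xz; have -> : x ^+ 2 * (n%:R - d%:R) = d%:R * m%:~R.
  by apply: (mulfI (expf_neq0 2 beta0)); rewrite mulrA -exprMn -Nx hdm; ring.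
rewrite ler_pM2l ?ltr0n ?dim_obtf_gt0 //.
have n0 : (0 < n)%N by apply: leq_ltn_trans dn.
have -> : n%:R - 1 = #|predC1 i|%:R :> R by rewrite cardC1 -subn1 natrB.
rewrite -sum1_card natr_sum rmorph_sum /=.
by apply: ler_sum => j ji; rewrite sgn_sqr; case: (_ != 0).
Qed.
End Integrality.

(** The inverse of the coherence is an integer whose square is at most
    [d (n - 1) / (n - d)], which is less than [(k + 1)^2]. *)
Lemma obtf_coherence_bound (R : realType) (T K : finType)
    (W : {vspace fvec R T}) (psi : K -> fvec R T) (k : nat) :
  ob_tight_frame W psi -> #|K| != (2 * \dim W)%N -> (\dim W < #|K|)%N ->
  (\dim W * #|K|.-1 < k.+1 ^ 2 * (#|K| - \dim W))%N ->
  k%:R^-1 <= coherence psi.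
Proof.
move=> [[psiW [a _ tight]] [[r r0 normr] [beta beta_ge0 psi_beta]]] n2d dn hk.
have sqN i : dotp (psi i) (psi i) = r ^+ 2 by rewrite -enorm_sqr normr.
have N_gt0 : 0 < r ^+ 2 by rewrite exprn_even_gt0.
have [z Nz hz] :=
  norm_over_beta_integral psiW tight N_gt0 sqN psi_beta beta_ge0 n2d dn.
have [i [j [ij g0]]] := obtf_nonorthogonal psiW tight N_gt0 sqN dn.
apply: le_trans (ge_coherence psi ij).
have -> : `|dotp (psi i) (psi j)| = beta.
  case: (psi_beta _ _ ij) g0 => ->; rewrite ?eqxx // => _.
    by rewrite ger0_norm.
  by rewrite normrN ger0_norm.
rewrite !normr -expr2 Nz.
have zb_gt0 : 0 < beta * z%:~R by rewrite -Nz.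
have b_gt0 : 0 < beta.
  rewrite lt0r beta_ge0 andbT; apply: contraTneq zb_gt0 => ->.
  by rewrite mul0r ltxx.
have z_gt0 : 0 < z by move: zb_gt0; rewrite pmulr_rgt0 // ltr0z.
rewrite invfM mulrA divff ?gt_eqF // mul1r.
have [->|k_gt0] := posnP k; first by rewrite invr0 invr_ge0 ler0z ltW.
rewrite lef_pV2 ?posrE ?ltr0n ?ltr0z //.
rewrite pmulrn ler_int leNgt; apply/negP => kz.
suff : ((k.+1 ^ 2 * (#|K| - \dim W))%:R <= (\dim W * #|K|.-1)%:R :> R).
  by rewrite ler_nat leqNgt hk.
rewrite natrM natrX natrB 1?ltnW // natrM -subn1 natrB ?(leq_ltn_trans _ dn) //.
apply: le_trans hz; apply: ler_wpM2r; first by rewrite subr_ge0 ler_nat ltnW.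
rewrite ler_sqr ?nnegrE ?ler0n ?ler0z ?(ltW z_gt0) //.
by rewrite pmulrn ler_int.
Qed.

(** * Super embeddings *)

Lemma lpnorm2 (R : realType) (T : finType) (x : fvec R T) :
  lpnorm 2%:E x = enorm x.
Proof.
rewrite /lpnorm powR12_sqrt; last by apply: sumr_ge0 => t _; apply: powR_ge0.
congr Num.sqrt; apply: eq_bigr => t _.
by rewrite powR_mulrn ?normr_ge0 // real_normK ?num_real // expr2.
Qed.

Section SuperEmbedding.
Variables (R : realType) (C : incidence) (k : nat) (l : line C).
Variable E : {linear fvec R 'I_k -> fvec R (point C)}.
Hypothesis sE : super_embedding l E.

Lemma super_embedding_dotp z w : dotp (E z) (E w) = dotp z w.
Proof.
case: sE => _ _ nE.
have sq y : dotp (E y) (E y) = dotp y y.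
  by rewrite -!enorm_sqr -!lpnorm2 nE // lee_fin ler1n.
have := sq (z + w); rewrite linearD /= !dotp_sqrD !sq; lra.
Qed.

Lemma super_embedding_supp z x : ~~ inc x l -> E z x = 0.
Proof. by case: sE => _ suppE _ xl; rewrite suppE // inE. Qed.

(** The uniform norm bounds each of the [k] values on the line by [1], and the
    sum of their squares is [k]. *)
Lemma super_embedding_sign (z : fvec R 'I_k) x :
  (forall i, `|z i : R| = 1) -> inc x l -> `|E z x : R| = 1.
Proof.
move=> z1 xl; case: (sE) => ck suppE nE.
have le1 y : `|E z y : R| <= 1.
  have := nE z +oo%E; rewrite leey => /(_ isT); rewrite /lpnorm => e.
  apply: (@le_trans _ _ (\big[Num.max/0]_t `|E z t : R|)).
    exact: (@le_bigmax _ _ _ 0 (fun t => `|E z t : R|) y).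
  by rewrite e; apply: bigmax_le => // i _; rewrite z1.
have : \sum_(y in on_line l) (1 - `|E z y : R| ^+ 2) = 0.
  rewrite sumrB sumr_const ck; apply/eqP; rewrite subr_eq0; apply/eqP.
  transitivity (dotp z z).
    rewrite -[k in LHS]card_ord -sumr_const; apply: eq_bigr => i _.
    by rewrite -expr2 -real_normK ?num_real // z1 expr1n.
  rewrite -super_embedding_dotp; symmetry.
  rewrite big_mkcond; apply: eq_bigr => y _.
  case: ifPn => yl; first by rewrite real_normK ?num_real // expr2.
  by rewrite suppE // mul0r.
move=> /psumr_eq0P h.
have/h : forall y, y \in on_line l -> 0 <= 1 - `|E z y : R| ^+ 2.
  by move=> y _; rewrite subr_ge0 expr_le1.
move=> /(_ x); rewrite inE => /(_ xl)/eqP; rewrite subr_eq0 eq_sym sqrf_eq1.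
case/orP => /eqP // e; have := normr_ge0 (E z x : R).
by rewrite e oppr_ge0 ler10.
Qed.
End SuperEmbedding.

(** * Configurations *)

(** The classical configurations with [r] lines on each point and [k] points on
    each line.  The last axiom is stated symmetrically in points and lines, so
    that it is its own dual. *)
Record configuration (r k : nat) (C : incidence) : Prop := Configuration {
  card_pencil : forall x : point C, #|[set l : line C | inc x l]| = r;
  card_line : forall l : line C, #|on_line l| = k;
  meet_once : forall (x y : point C) (l m : line C),
    inc x l -> inc y l -> inc x m -> inc y m -> x = y \/ l = m }.

Lemma configuration_dual r k C :
  configuration r k C -> configuration k r (dual C).
Proof.
case=> cr ck mo; split=> [l|x|l m x y xl xm yl ym].
- by rewrite -(ck l); apply: eq_card => x; rewrite !inE.
- by rewrite -(cr x); apply: eq_card => l; rewrite !inE.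
- by case: (mo x y l m xl yl xm ym); [right|left].
Qed.

Definition joined (C : incidence) := forall x y : point C, x != y ->
  #|[set l | inc x l & inc y l]| = 1%N.

(** Both sides count the flags [(y, l)] with [y] different from [x] and [l]
    through [x]. *)
Lemma sum_common_lines (C : incidence) (x : point C) :
  (\sum_(y | y != x) #|[set l | inc x l & inc y l]| =
   \sum_(l | inc x l) #|on_line l|.-1)%N.
Proof.
under eq_bigr => y _.
  rewrite -sum1_card (eq_bigl (fun l => inc x l && inc y l)); last first.
    by move=> l; rewrite inE.
  rewrite big_mkcondr; over.
rewrite exchange_big /=; apply: eq_bigr => l xl.
rewrite -big_mkcondr sum1_card (cardsD1 x) inE xl.
by apply: eq_card => y; rewrite !inE.
Qed.

(** * The Gram matrix of the lifted vectors *)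

Section Gram.
Variables (R : realType) (C : incidence) (r k m : nat) (V : 'M[R]_(k, m)).
Variable E : line C -> {linear fvec R 'I_k -> fvec R (point C)}.
Variable delta : bool.
Hypothesis cC : configuration r k C.
Hypothesis sE : forall l, super_embedding l (E l).
Hypothesis V1 : forall i j, `|V i j| = 1.
Hypothesis Vdot : forall i j, i != j ->
  dotp (colv V i) (colv V j) ^+ 2 = delta%:R.

Lemma colv_dotp j : dotp (colv V j) (colv V j) = k%:R.
Proof.
rewrite -[k in RHS]card_ord -sumr_const; apply: eq_bigr => i _.
by rewrite -expr2 -real_normK ?num_real // ffunE V1 expr1n.
Qed.

Lemma lifted_same_line l i j :
  dotp (lifted E V (l, i)) (lifted E V (l, j)) = dotp (colv V i) (colv V j).
Proof. exact: super_embedding_dotp. Qed.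

Lemma lifted_diff_line l l' i j : l != l' ->
  dotp (lifted E V (l, i)) (lifted E V (l', j)) ^+ 2 =
  #|[set x : point C | inc x l & inc x l']|%:R.
Proof.
move=> ll'; rewrite /lifted /=.
have sE0 := super_embedding_supp (sE _).
have [A0|[x]] := set_0Vmem [set x | inc x l & inc x l'].
  rewrite A0 cards0 /dotp big1 ?expr0n // => y _.
  have : y \notin [set x | inc x l & inc x l'] by rewrite A0 inE.
  by rewrite inE negb_and => /orP[] /sE0 ->; rewrite ?mul0r ?mulr0.
rewrite inE => /andP[xl xl'].
have uniqx y : inc y l -> inc y l' -> y = x.
  move=> yl yl'; case: (meet_once cC xl yl xl' yl') => // e.
  by rewrite e eqxx in ll'.
rewrite (_ : [set _ | _ & _] = [set x]); last first.
  apply/setP => y; rewrite !inE; apply/andP/eqP => [[yl yl']|->] //.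
  exact: uniqx.
rewrite cards1 /dotp (bigD1 x) //= big1 ?addr0 => [|y yx].
  rewrite -real_normK ?num_real // normrM !(super_embedding_sign (sE _)) //.
  - by rewrite mulr1 expr1n.
  - by move=> i0; rewrite ffunE.
  - by move=> i0; rewrite ffunE.
have [yl|/sE0 ->] := boolP (inc y l); last by rewrite mul0r.
have [yl'|/sE0 ->] := boolP (inc y l'); last by rewrite mulr0.
by rewrite (uniqx _ yl yl') eqxx in yx.
Qed.

Lemma lifted_norm p : dotp (lifted E V p) (lifted E V p) = k%:R.
Proof. by case: p => l j; rewrite lifted_same_line colv_dotp. Qed.

Lemma card_meet_le1 l l' : l != l' ->
  (#|[set x : point C | inc x l & inc x l']| <= 1)%N.
Proof.
move=> ll'; apply/card_le1_eqP => y x.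
rewrite !inE => /andP[xl xl'] /andP[yl yl'].
by case: (meet_once cC xl yl xl' yl') => // e; rewrite e eqxx in ll'.
Qed.

Lemma lifted_dotp_sqr p p' : p != p' ->
  exists b : bool, dotp (lifted E V p) (lifted E V p') ^+ 2 = b%:R.
Proof.
case: p p' => l i [l' j]; have [<-|ll'] := eqVneq l l'.
  rewrite xpair_eqE eqxx /= => ij; exists delta.
  by rewrite lifted_same_line Vdot.
move=> _; have := card_meet_le1 ll'; rewrite lifted_diff_line //.
by case: #|_| => [|[|]] // _; [exists false|exists true].
Qed.

Lemma sum_meet l :
  (\sum_(l' | l' != l) #|[set x : point C | inc x l & inc x l']| = k * r.-1)%N.
Proof.
etransitivity; first exact: (@sum_common_lines (dual C) l).
rewrite -(card_line cC l) -sum_nat_const; apply: eq_big => x.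
  by rewrite inE.
by rewrite (card_line (configuration_dual cC)).
Qed.

(** The three terms come from the vector itself, the other vectors on its
    line, and the vectors on the lines that meet its line. *)
Lemma lifted_frame_row p :
  \sum_p' dotp (lifted E V p) (lifted E V p') ^+ 2 =
  (k ^ 2 + m.-1 * delta + k * r.-1 * m)%N%:R.
Proof.
case: p => l i; rewrite -(pair_bigA _ (fun l' j =>
  dotp (lifted E V (l, i)) (lifted E V (l', j)) ^+ 2)) /=.
rewrite (bigD1 l) //= (bigD1 i) //= lifted_norm -natrX 2!natrD.
congr (_ + _ + _).
  under eq_bigr => j ji do rewrite lifted_same_line Vdot 1?eq_sym //.
  by rewrite sumr_const cardC1 card_ord natrM [RHS]mulr_natl.
under eq_bigr => l' ll'.
  under eq_bigr => j _ do rewrite lifted_diff_line 1?eq_sym //.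
  rewrite sumr_const card_ord -[_ *+ m]mulr_natr.
  over.
by rewrite -mulr_suml -natr_sum sum_meet -natrM.
Qed.

Lemma lifted_orthobiangular : (0 < k)%N -> orthobiangular (lifted E V).
Proof.
move=> k0; split.
  exists (Num.sqrt k%:R) => [|p]; first by rewrite sqrtr_eq0 -ltNge ltr0n.
  by rewrite /enorm lifted_norm.
exists 1 => // p p' /lifted_dotp_sqr[[] /eqP].
  by rewrite sqrf_eq1 => /orP[] /eqP ->; [apply: Or32|apply: Or33].
by rewrite sqrf_eq0 => /eqP ->; apply: Or31.
Qed.

(** Each row sum equals the frame constant times [k], and the trace identity
    relates the frame constant to the dimension.  Signs of the inner products
    do not matter, so the dimension is the same for all super embeddings. *)
Lemma lifted_dim : (0 < k)%N -> (0 < #|line C|)%N -> (0 < m)%N ->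
  tight_frame (fspan (lifted E V)) (lifted E V) ->
  (\dim (fspan (lifted E V)) * (k ^ 2 + m.-1 * delta + k * r.-1 * m) =
   #|line C| * m * k ^ 2)%N.
Proof.
move=> k0 /card_gt0P[l _] m0 [phiW [a a0 tight]].
have := tight_trace phiW tight.
under eq_bigr do rewrite lifted_norm.
rewrite sumr_const card_prod card_ord => tr.
have row : (k ^ 2 + m.-1 * delta + k * r.-1 * m)%N%:R = a * k%:R.
  rewrite -(lifted_frame_row (l, Ordinal m0)) -(lifted_norm (l, Ordinal m0)).
  rewrite -(tight_polar tight) //; apply: eq_bigr => p _; exact: expr2.
apply/eqP; rewrite -(eqr_nat R) natrM row mulrA (mulrC _ a) -tr.
by rewrite natrM natrX expr2 mulrA [_%:R * k%:R]mulr_natl.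
Qed.

Lemma lifted_coherence :
  (0 < k)%N -> (0 < #|line C|)%N -> (0 < m)%N -> (1 < r)%N ->
  coherence (lifted E V) = k%:R^-1.
Proof.
move=> k0 /card_gt0P[l _] m0 r1.
have nrm p : enorm (lifted E V p) = Num.sqrt k%:R by rewrite /enorm lifted_norm.
have den p p' : enorm (lifted E V p) * enorm (lifted E V p') = k%:R.
  by rewrite !nrm -expr2 sqr_sqrtr.
apply: le_anti; apply/andP; split.
  apply: bigmax_le => [|[p p'] /= pp']; first by rewrite invr_ge0.
  rewrite den ler_pdivrMr ?ltr0n // mulVf ?pnatr_eq0 -?lt0n //.
  rewrite -(expr_le1 (n := 2)) // real_normK ?num_real //.
  by have [b ->] := lifted_dotp_sqr pp'; case: b.
have /card_gt0P[x] : (0 < #|on_line l|)%N by rewrite (card_line cC).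
rewrite inE => xl.
have /card_gt0P[l'] : (0 < #|[set l' : line C | inc x l'] :\ l|)%N.
  have := cardsD1 l [set l' : line C | inc x l'].
  by rewrite (card_pencil cC) inE xl; lia.
rewrite !inE => /andP[l'l xl'].
pose j := Ordinal m0.
have pp' : (l, j) != (l', j) by rewrite xpair_eqE eq_sym (negPf l'l).
have := ge_coherence (lifted E V) pp'; rewrite den.
suff -> : `|dotp (lifted E V (l, j)) (lifted E V (l', j))| = 1 by rewrite mul1r.
apply/eqP; rewrite -(eqrXn2 (n := 2)) // real_normK ?num_real // expr1n.
rewrite lifted_diff_line 1?eq_sym // eq_sym pnatr_eq1 eqn_leq.
rewrite card_meet_le1 1?eq_sym //=.
by apply/card_gt0P; exists x; rewrite inE xl xl'.
Qed.
End Gram.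

(** * Existence of tight lifts *)

Section Embedding.
Variables (R : realType) (C : incidence) (r k : nat).
Hypothesis cC : configuration r k C.

Definition line_point (l : line C) (i : 'I_k) : point C :=
  enum_val (cast_ord (esym (card_line cC l)) i).

Lemma line_point_inj l : injective (line_point l).
Proof. by move=> i j /enum_val_inj/cast_ord_inj. Qed.

Lemma sum_line_point l (g : point C -> R) :
  \sum_i g (line_point l i) = \sum_(x in on_line l) g x.
Proof.
rewrite [RHS]big_enum_val [RHS](reindex (cast_ord (esym (card_line cC l)))) //.
by exists (cast_ord (card_line cC l)) => i _; rewrite ?cast_ordK ?cast_ordKV.
Qed.

(** The sum has at most one term; this form makes linearity immediate. *)
Definition zero_extend (l : line C) (z : fvec R 'I_k) : fvec R (point C) :=
  [ffun x => \sum_(i | line_point l i == x) z i].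

Lemma zero_extend_is_linear l : linear (zero_extend l).
Proof.
move=> a z w; apply/ffunP => x; rewrite !ffunE scaler_sumr -big_split.
by apply: eq_bigr => i _; rewrite !ffunE.
Qed.

HB.instance Definition _ l := GRing.isLinear.Build R (fvec R 'I_k)
  (fvec R (point C)) *:%R (zero_extend l) (zero_extend_is_linear l).

Lemma zero_extend_on l z i : zero_extend l z (line_point l i) = z i.
Proof.
rewrite ffunE (big_pred1 i) // => j; rewrite /= eq_sym.
by rewrite (inj_eq (@line_point_inj l)) eq_sym.
Qed.

Lemma zero_extend_off l z x : x \notin on_line l -> zero_extend l z x = 0.
Proof.
move=> xl; rewrite ffunE big_pred0 // => i; apply: contraNF xl => /eqP <-.
exact: enum_valP.
Qed.

Lemma dotp_zero_extend l (x : fvec R (point C)) z :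
  dotp x (zero_extend l z) = dotp [ffun i => x (line_point l i)] z.
Proof.
transitivity (\sum_(y in on_line l) x y * zero_extend l z y).
  rewrite [RHS]big_mkcond; apply: eq_bigr => y _.
  by case: ifPn => // yl; rewrite zero_extend_off ?mulr0.
rewrite -(sum_line_point l (fun y => x y * zero_extend l z y)).
by apply: eq_bigr => i _; rewrite zero_extend_on ffunE.
Qed.

Lemma zero_extend_super l : super_embedding l (zero_extend l).
Proof.
split=> [|z x /zero_extend_off ->|z p p1] //; first exact: card_line cC l.
case: p p1 => [s||] //= s1.
  congr (_ `^ _); have s0 : s != 0.
    by rewrite gt_eqF // (lt_le_trans ltr01) // -lee_fin.
  transitivity (\sum_(y in on_line l) `|zero_extend l z y| `^ s).
    rewrite [RHS]big_mkcond; apply: eq_bigr => y _.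
    by case: ifPn => // yl; rewrite zero_extend_off // normr0 powR0.
  rewrite -(sum_line_point l (fun y => `|zero_extend l z y| `^ s)).
  by apply: eq_bigr => i _; rewrite zero_extend_on.
apply: le_anti; apply/andP; split; apply: bigmax_le; rewrite ?bigmax_ge_id //.
  move=> y _; have [yl|yl] := boolP (y \in on_line l); last first.
    by rewrite zero_extend_off // normr0 bigmax_ge_id.
  have [i ->] : exists i, y = line_point l i.
    exists (cast_ord (card_line cC l) (enum_rank_in yl y)).
    by rewrite /line_point cast_ordK enum_rankK_in.
  rewrite zero_extend_on; exact: (@le_bigmax _ _ _ 0 (fun i => `|z i : R|)).
move=> i _; rewrite -(zero_extend_on l).
exact: (@le_bigmax _ _ _ 0 (fun y => `|zero_extend l z y : R|)).
Qed.

Lemma sum_lines (g : point C -> R) :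
  \sum_l \sum_(x in on_line l) g x = r%:R * \sum_x g x.
Proof.
under eq_bigr do rewrite big_mkcond.
rewrite exchange_big mulr_sumr; apply: eq_bigr => x _.
rewrite -big_mkcond -(card_pencil cC x) mulr_natl -sumr_const /=.
by apply: eq_bigl => l; rewrite !inE.
Qed.

Section Tight.
Variables (m : nat) (V : 'M[R]_(k, m)) (c : nat).

(** An identity that holds on some space containing all the lifts holds on
    their span, so the span need not be determined. *)
Lemma tight_frame_span (W : {vspace fvec R (point C)}) (a : R) :
  (forall l j, zero_extend l (colv V j) \in W) -> 0 < a ->
  (forall x, x \in W ->
    \sum_l \sum_j dotp x (zero_extend l (colv V j)) ^+ 2 = a * dotp x x) ->
  tight_frame (fspan (lifted (fun l => zero_extend l) V))
              (lifted (fun l => zero_extend l) V).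
Proof.
move=> VW a0 tight; split=> [p|].
  by apply: memv_span; apply: codom_f.
exists a => // x xs; rewrite enorm_sqr -tight; last first.
  by apply: (subvP _ x xs); apply/span_subvP => _ /codomP[[l j] ->]; apply: VW.
rewrite pair_bigA /=; apply: eq_bigr => p _.
by rewrite real_normK ?num_real.
Qed.

Lemma tight_parseval : (0 < r)%N -> (0 < c)%N ->
  (forall z, \sum_j dotp z (colv V j) ^+ 2 = c%:R * dotp z z) ->
  tight_frame (fspan (lifted (fun l => zero_extend l) V))
              (lifted (fun l => zero_extend l) V).
Proof.
move=> r0 c0 VV; apply: (@tight_frame_span fullv (c%:R * r%:R)).
- by move=> l j; rewrite memvf.
- by rewrite mulr_gt0 ?ltr0n.
move=> x _; under eq_bigr => l _.
  under eq_bigr => j _ do rewrite dotp_zero_extend.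
  rewrite VV.
  over.
rewrite -mulr_sumr -mulrA /dotp -sum_lines; congr (_ * _).
apply: eq_bigr => l _.
by rewrite -sum_line_point; apply: eq_bigr => i _; rewrite !ffunE.
Qed.

(** Expanding the squares, [f x * f y] occurs once for each line through [x]
    and [y]: [r] times if [x = y], and once otherwise. *)
Lemma sum_line_sqr (f : point C -> R) :
  joined C ->
  \sum_l (\sum_(x in on_line l) f x) ^+ 2 =
  (r%:R - 1) * \sum_x f x ^+ 2 + (\sum_x f x) ^+ 2.
Proof.
move=> join.
transitivity
  (\sum_x \sum_y f x * f y *+ #|[set l | inc x l & inc y l]|).
  transitivity
    (\sum_l \sum_x \sum_y (if inc x l && inc y l then f x * f y else 0)).
    apply: eq_bigr => l _; rewrite expr2 mulr_suml big_mkcond.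
    apply: eq_bigr => x _; rewrite inE; case: (inc x l); last by rewrite big1.
    rewrite mulr_sumr big_mkcond; apply: eq_bigr => y _; by rewrite inE.
  rewrite exchange_big; apply: eq_bigr => x _; rewrite exchange_big.
  apply: eq_bigr => y _; rewrite -big_mkcond -sumr_const.
  by apply: eq_bigl => l; rewrite !inE.
rewrite expr2 mulr_suml mulr_sumr -big_split; apply: eq_bigr => x _ /=.
rewrite mulr_sumr (bigD1 x) //= [X in _ = _ + X](bigD1 x) //=.
rewrite (_ : #|_| = r); last first.
  by rewrite -(card_pencil cC x); apply: eq_card => l; rewrite !inE andbb.
rewrite addrA -mulr_natl mulrBl mul1r expr2 subrK; congr (_ + _).
by apply: eq_bigr => y yx; rewrite join 1?eq_sym.
Qed.

(** For a vector of zero sum, [sum_line_sqr] turns the squares subtracted on the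
    lines into [r - 1] times the squared norm; all the lifts have zero sum. *)
Lemma tight_simplex : (0 < r)%N -> (0 < c)%N ->
  joined C ->
  (forall z : fvec R 'I_k, \sum_j dotp z (colv V j) ^+ 2 =
     c%:R * dotp z z - (\sum_i (z i : R)) ^+ 2) ->
  (forall j, \sum_i V i j = 0) ->
  tight_frame (fspan (lifted (fun l => zero_extend l) V))
              (lifted (fun l => zero_extend l) V).
Proof.
move=> r0 c0 join VV V0.
pose one : fvec R (point C) := [ffun=> 1].
have dot1 x : dotp x one = \sum_y (x y : R).
  by apply: eq_bigr => y _; rewrite ffunE mulr1.
have lin : linear (fun x : fvec R (point C) => dotp x one : R^o).
  by move=> a x y; rewrite dotpDl dotpZl.
pose h := HB.pack_for {linear fvec R (point C) -> R^o}
  (fun x : fvec R (point C) => dotp x one : R^o)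
  (GRing.isLinear.Build R _ _ _ _ lin).
apply: (@tight_frame_span (lker (linfun h)) (c%:R * r%:R - (r%:R - 1))).
- move=> l j; rewrite memv_ker lfunE /= dotpC dotp_zero_extend.
  rewrite -[X in _ == X](V0 j).
  by apply/eqP; apply: eq_bigr => i _; rewrite !ffunE mul1r.
- rewrite subr_gt0; apply: (lt_le_trans (y := r%:R)); first by rewrite gtrBl.
  by rewrite -natrM ler_nat leq_pmull.
move=> x; rewrite memv_ker lfunE /= dot1 => /eqP x0.
under eq_bigr => l _.
  under eq_bigr => j _ do rewrite dotp_zero_extend.
  rewrite VV (eq_bigr (fun i => x (line_point l i))) => [|i _]; last first.
    by rewrite ffunE.
  rewrite (sum_line_point l x).
  over.
rewrite sumrB sum_line_sqr // x0 expr0n addr0 [RHS]mulrBl; congr (_ - _ * _).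
  rewrite -mulr_sumr -mulrA /dotp -sum_lines; congr (_ * _).
  apply: eq_bigr => l _.
  by rewrite -sum_line_point; apply: eq_bigr => i _; rewrite !ffunE.
Qed.
End Tight.
End Embedding.

(** * Optimality from numerical parameters *)

(** The two inequalities say that the square of the coherence divided by that
    of the Welch bound lies between [1] and [1 + 1 / q]; the quotient itself
    is then also at most [1 + 1 / q]. *)
Lemma near_welchP (R : realType) (T K : finType) (phi : K -> fvec R T)
    (k q : nat) :
  let n := #|K| in let d := \dim (fspan phi) in
  (0 < k)%N -> (0 < q)%N -> (0 < d < n)%N -> coherence phi = k%:R^-1 ->
  (k ^ 2 * (n - d) <= d * n.-1)%N ->
  (q * (d * n.-1) <= q.+1 * (k ^ 2 * (n - d)))%N ->
  near_welch q%:R^-1 phi.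
Proof.
move=> n d k0 q0 /andP[d0 dn] cohE lo hi; rewrite /near_welch cohE /welch.
rewrite -/n -/d.
have nR : n%:R - 1 = n.-1%:R :> R by rewrite -subn1 natrB ?(leq_ltn_trans _ dn).
rewrite -natrB 1?ltnW // nR.
have A0 : 0 < (n - d)%:R :> R by rewrite ltr0n subn_gt0.
have B0 : 0 < d%:R * n.-1%:R :> R.
  by rewrite -natrM ltr0n muln_gt0 d0 -subn1 subn_gt0 (leq_ltn_trans _ dn).
set w := Num.sqrt _.
have w2 : w ^+ 2 = (n - d)%:R / (d%:R * n.-1%:R).
  by rewrite sqr_sqrtr // divr_ge0 ?ltW.
have w0 : 0 <= w by apply: sqrtr_ge0.
have kR : 0 < k%:R :> R by rewrite ltr0n.
have qR : 0 < q%:R :> R by rewrite ltr0n.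
have wk : w <= k%:R^-1.
  rewrite -ler_sqr ?nnegrE ?invr_ge0 ?(ltW kR) // w2 exprVn.
  rewrite ler_pdivrMr // mulrC ler_pdivlMr ?exprn_gt0 //.
  by rewrite -natrX -!natrM ler_nat mulnC.
have e0 : 0 < q%:R^-1 :> R by rewrite invr_gt0.
have kw : k%:R^-1 <= (1 + q%:R^-1) * w.
  have e1 : 0 <= 1 + q%:R^-1 :> R by rewrite addr_ge0 // ltW.
  rewrite -ler_sqr ?nnegrE ?invr_ge0 ?mulr_ge0 ?(ltW kR) // exprMn w2.
  apply: (@le_trans _ _ ((1 + q%:R^-1) * ((n - d)%N%:R / (d%:R * n.-1%:R)))).
    rewrite mulrA ler_pdivlMr // exprVn mulrC ler_pdivrMr ?exprn_gt0 //.
    rewrite -(ler_pM2l qR).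
    have -> : q%:R * ((1 + q%:R^-1) * (n - d)%N%:R * k%:R ^+ 2) =
      (q%:R + 1) * ((n - d)%N%:R * k%:R ^+ 2) :> R by field; rewrite gt_eqF.
    by rewrite natr1 -natrX -!natrM ler_nat (mulnC (n - d)%N).
  apply: ler_wpM2r; first by rewrite divr_ge0 ?ltW.
  by rewrite expr2 ler_peMl // lerDl ltW.
by rewrite ger0_norm ?subr_ge0 // lerBlDr -[X in _ + X]mul1r -mulrDl addrC.
Qed.

Section Optimal.
Variables (R : realType) (C : incidence) (r k m : nat) (V : 'M[R]_(k, m)).
Variable delta : bool.
Hypothesis cC : configuration r k C.

(** The equation for [d] is the one of [lifted_dim]; the next two conditions
    are required by [obtf_coherence_bound].  The last three place
    [d (n - 1) / (n - d)] at least at [k^2], below [(k + 1)^2] and at most at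
    [(1 + 1 / q) k^2]. *)
Lemma optimal_pairP (q d : nat) :
  let n := (#|line C| * m)%N in
  (forall i j, `|V i j| = 1) ->
  (forall i j, i != j -> dotp (colv V i) (colv V j) ^+ 2 = delta%:R) ->
  tight_frame (fspan (lifted (fun l => zero_extend (R := R) cC l) V))
              (lifted (fun l => zero_extend (R := R) cC l) V) ->
  (0 < q)%N -> (0 < k)%N -> (1 < r)%N -> (0 < n)%N ->
  (d * (k ^ 2 + m.-1 * delta + k * r.-1 * m) = n * k ^ 2)%N ->
  (0 < d < n)%N -> n != (2 * d)%N ->
  (k ^ 2 * (n - d) <= d * n.-1)%N ->
  (d * n.-1 < k.+1 ^ 2 * (n - d))%N ->
  (q * (d * n.-1) <= q.+1 * (k ^ 2 * (n - d)))%N ->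
  optimal_pair q%:R^-1 C V.
Proof.
move=> n V1 Vdot tight q0 k0 r1 n0 dE dn n2d lo gap hi.
have /andP[L0 m0] : (0 < #|line C|)%N && (0 < m)%N by rewrite -muln_gt0.
split.
  exists (fun l => zero_extend cC l); split.
    by move=> l; apply: zero_extend_super.
  split=> //; apply: lifted_orthobiangular cC _ V1 Vdot k0 => l.
  exact: zero_extend_super.
move=> E [sE [tE _]].
have nE : #|{: line C * 'I_m}| = n by rewrite card_prod card_ord.
have dimE : \dim (fspan (lifted E V)) = d.
  apply/eqP; rewrite -(eqn_pmul2r (m := k ^ 2 + m.-1 * delta + k * r.-1 * m)).
    by rewrite (lifted_dim cC sE V1 Vdot) // dE.
  by rewrite 2!addn_gt0 expn_gt0 k0.
have cohE := lifted_coherence cC sE V1 Vdot k0 L0 m0 r1.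
split; first by apply: (@near_welchP _ _ _ _ k); rewrite // ?dimE ?nE.
move=> T' K' W psi cK dW obt; apply/negP; rewrite -leNgt cohE.
by apply: (obtf_coherence_bound obt); rewrite dW cK dimE nE //; case/andP: dn.
Qed.
End Optimal.

(** * Projective and affine planes *)

Section Planes.
Variables (C : incidence).

Lemma unique_line_joined :
  (forall x y : point C, x <> y -> exists! l : line C, inc x l /\ inc y l) ->
  joined C.
Proof.
move=> h x y /eqP /h[l [[xl yl] ul]]; apply/eqP/cards1P; exists l.
apply/setP => l'; rewrite !inE; apply/andP/eqP => [[xl' yl']|->] //.
by rewrite -(ul l').
Qed.

Lemma joined_meet_once : joined C ->
  forall (x y : point C) (l m : line C),
    inc x l -> inc y l -> inc x m -> inc y m -> x = y \/ l = m.
Proof.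
move=> jC x y l m xl yl xm ym; have [->|xy] := eqVneq x y; first by left.
right; have /eqP/cards1P[l0 e] := jC _ _ xy.
have : l \in [set l0] by rewrite -e inE xl yl.
have : m \in [set l0] by rewrite -e inE xm ym.
by rewrite !inE => /eqP -> /eqP ->.
Qed.

(** The lines through [x] partition the other points into classes of size
    [k - 1]. *)
Lemma joined_pencil k (x : point C) : joined C ->
  (forall l : line C, #|on_line l| = k) ->
  (#|point C|.-1 = #|[set l : line C | inc x l]| * k.-1)%N.
Proof.
move=> jC ck; rewrite -(cardC1 x) -[RHS]sum_nat_const -[LHS]sum1_card.
transitivity (\sum_(y | y != x) #|[set l | inc x l & inc y l]|)%N.
  by apply: eq_bigr => y yx; rewrite jC 1?eq_sym.
rewrite sum_common_lines; apply: eq_big => [l|l _]; first by rewrite inE.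
by rewrite ck.
Qed.
End Planes.

Lemma projective_configuration q C : (0 < q)%N -> projective_plane q C ->
  configuration q.+1 q.+1 C /\ joined C.
Proof.
move=> q0 [cP cL ck /unique_line_joined jC _]; split=> //.
split=> // [x|]; last exact: joined_meet_once.
have := joined_pencil x jC ck; rewrite cP /=.
by nia.
Qed.

Lemma affine_configuration q C : (1 < q)%N -> affine_plane q C ->
  configuration q.+1 q C /\ joined C.
Proof.
move=> q0 [cP cL ck /unique_line_joined jC]; split=> //.
split=> // [x|]; last exact: joined_meet_once.
have := joined_pencil x jC ck; rewrite cP /=.
case: q q0 {cP cL ck} => [|[|q]] // _.
by move: #|_| => s; nia.
Qed.

(** * Hadamard matrices *)

Lemma parseval (R : realType) k m (V : 'M[R]_(k, m)) (c : R) :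
  (forall i i', \sum_j V i j * V i' j = c * (i == i')%:R) ->
  forall z, \sum_j dotp z (colv V j) ^+ 2 = c * dotp z z.
Proof.
move=> VV z.
transitivity (\sum_i \sum_i' (z i * z i' * (\sum_j V i j * V i' j))).
  under [RHS]eq_bigr do under eq_bigr do rewrite mulr_sumr.
  under [RHS]eq_bigr do rewrite exchange_big /=.
  rewrite [RHS]exchange_big; apply: eq_bigr => j _ /=.
  rewrite expr2 mulr_suml; apply: eq_bigr => i _; rewrite mulr_sumr.
  by apply: eq_bigr => i' _; rewrite !ffunE; ring.
rewrite [RHS]mulr_sumr; apply: eq_bigr => i _.
rewrite (bigD1 i) //= [X in _ + X]big1 => [|i' ii'].
  by rewrite VV eqxx addr0 mulr1 mulrC.
by rewrite VV eq_sym (negPf ii') !mulr0.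
Qed.

Section Hadamard.
Variables (R : realType) (q : nat) (H : 'M[R]_q.+1) (r : 'I_q.+1).
Hypothesis hH : hadamard H.
Hypothesis Hr : forall j, H r j = 1.
Let Hm : 'M[R]_(q, q.+1) := row' r H.

Lemma hadamard_norm i j : `|H i j| = 1.
Proof. by case: (hH.1 i j) => ->; rewrite ?normrN normr1. Qed.

Lemma hadamard_sqr i j : H i j * H i j = 1.
Proof. by rewrite -expr2 -real_normK ?num_real // hadamard_norm expr1n. Qed.

Lemma hadamard_row i i' : \sum_j H i j * H i' j = q.+1%:R * (i == i')%:R.
Proof.
have [<-|ii'] := eqVneq i i'; last by rewrite mulr0; apply: hH.2.
by under eq_bigr do rewrite hadamard_sqr; rewrite sumr_const card_ord mulr1.
Qed.

(** A one-sided inverse of a square matrix is two-sided, so the columns are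
    orthogonal as well. *)
Lemma hadamard_col j j' : \sum_i H i j * H i j' = q.+1%:R * (j == j')%:R.
Proof.
have q0 : q.+1%:R != 0 :> R by rewrite pnatr_eq0.
have : H *m (q.+1%:R^-1 *: H^T) = 1%:M.
  apply/matrixP => i i'; rewrite -scalemxAr !mxE.
  under eq_bigr do rewrite mxE.
  by rewrite hadamard_row mulKf.
move/mulmx1C => /matrixP/(_ j j'); rewrite -scalemxAl !mxE => e.
rewrite -e mulVKf //; apply: eq_bigr => i _; by rewrite mxE.
Qed.

Lemma hadamard_colv i j : i != j -> dotp (colv H i) (colv H j) ^+ 2 = false%:R.
Proof.
move=> ij; rewrite /dotp; under eq_bigr do rewrite !ffunE.
by rewrite hadamard_col (negPf ij) mulr0 expr0n.
Qed.

(** Deleting the row of ones changes the inner product [0] of two columns to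
    [-1]. *)
Lemma hadamard_row'_colv i j : i != j ->
  dotp (colv Hm i) (colv Hm j) ^+ 2 = true%:R.
Proof.
move=> ij; have := hadamard_col i j.
rewrite (negPf ij) mulr0 (bigD1_ord r) //= !Hr mulr1 => /eqP.
rewrite addrC addr_eq0 => /eqP e.
rewrite /dotp; under eq_bigr do rewrite !ffunE !mxE.
by rewrite e sqrrN expr1n.
Qed.

Lemma hadamard_tr_row'_colv i j : i != j ->
  dotp (colv Hm^T i) (colv Hm^T j) ^+ 2 = false%:R.
Proof.
move=> ij; rewrite /dotp; under eq_bigr do rewrite !ffunE !mxE.
by rewrite hadamard_row (inj_eq lift_inj) (negPf ij) mulr0 expr0n.
Qed.

Lemma hadamard_row'_parseval (z : fvec R 'I_q) :
  \sum_j dotp z (colv Hm j) ^+ 2 = q.+1%:R * dotp z z.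
Proof.
apply: parseval => i i'; under eq_bigr do rewrite !mxE.
by rewrite hadamard_row (inj_eq lift_inj).
Qed.

(** The rows of [H] satisfy Parseval's identity, and the square of the sum is
    the contribution of the row of ones. *)
Lemma hadamard_tr_row'_parseval (z : fvec R 'I_q.+1) :
  \sum_j dotp z (colv Hm^T j) ^+ 2 =
  q.+1%:R * dotp z z - (\sum_i (z i : R)) ^+ 2.
Proof.
have HT : forall i i', \sum_j H^T i j * H^T i' j = q.+1%:R * (i == i')%:R.
  by move=> i i'; under eq_bigr do rewrite !mxE; apply: hadamard_col.
rewrite -(parseval HT) (bigD1_ord r) //= addrC.
rewrite (_ : dotp z (colv H^T r) = \sum_i (z i : R)) ?addrK; last first.
  by apply: eq_bigr => i _; rewrite ffunE mxE Hr mulr1.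
apply: eq_bigr => j _; congr (dotp z _ ^+ 2).
by apply/ffunP => i; rewrite !ffunE !mxE.
Qed.

Lemma hadamard_tr_row'_sum j : \sum_i Hm^T i j = 0.
Proof.
have := hadamard_row (lift r j) r.
rewrite eq_sym (negPf (neq_lift r j)) mulr0 => e; rewrite -[RHS]e.
by apply: eq_bigr => i _; rewrite !mxE Hr mulr1.
Qed.

End Hadamard.

(** A sum of three signs is odd, so two rows cannot be orthogonal. *)
Lemma hadamard3 (R : realType) (H : 'M[R]_3) : ~ hadamard H.
Proof.
case=> H1 /(_ ord0 ord_max isT).
have unit j : H ord0 j * H ord_max j = 1 \/ H ord0 j * H ord_max j = -1.
  case: (H1 ord0 j) => ->; case: (H1 ord_max j) => ->;
    by rewrite ?mul1r ?mulN1r ?opprK; auto.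
rewrite !big_ord_recl big_ord0.
move: (unit ord0) (unit (lift ord0 ord0)) (unit (lift ord0 (lift ord0 ord0))).
by move=> [->|->] [->|->] [->|->]; lra.
Qed.

Lemma prime_power_gt1 q : prime_power q -> (1 < q)%N.
Proof.
by case=> p [k [pp k0 ->]]; rewrite -(exp1n k) ltn_exp2r // prime_gt1.
Qed.

Local Open Scope classical_set_scope.

Theorem theorem18 (R : realType) :
  exists2 eps : nat -> R, (eps @ \oo --> (0 : R)) &
  forall (q : nat) (H : 'M[R]_q.+1) (r : 'I_q.+1),
    prime_power q -> hadamard H -> (forall j, H r j = 1) ->
    let Hm : 'M[R]_(q, q.+1) := row' r H in
    (forall Pq : incidence, projective_plane q Pq ->
       optimal_pair (eps q) Pq H /\ optimal_pair (eps q) Pq Hm^T) /\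
    (forall Aq : incidence, affine_plane q Aq ->
       optimal_pair (eps q) Aq Hm /\ optimal_pair (eps q) (dual Aq) H).
Proof.
exists (fun q => q%:R^-1).
  by rewrite -cvg_shiftS; exact: cvg_harmonic.
move=> q H r /prime_power_gt1 q1 hH Hr Hm; have q0 := ltnW q1.
have H1 := hadamard_norm hH.
have HH : forall z, \sum_j dotp z (colv H j) ^+ 2 = q.+1%:R * dotp z z.
  by apply: parseval; apply: hadamard_row.
have Hm1 i j : `|Hm i j| = 1 by rewrite mxE.
have HmT1 i j : `|Hm^T i j| = 1 by rewrite !mxE.
(* A form of [q] that makes the truncated predecessors compute. *)
have [p qE] : exists p, q = p.+2.
  by exists q.-2; lia.
split=> C plane.
{ have [cC jC] := projective_configuration q0 plane.
  case: plane => _ cL _ _ _; split.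
  { apply: (optimal_pairP (delta := false) (cC := cC)
      (d := (q ^ 2 + q + 1)%N)) => //.
    - exact: hadamard_colv.
    - by apply: (tight_parseval cC (c := q.+1)).
    all: by rewrite ?cL ?qE /=; nia. }
  apply: (optimal_pairP (delta := false) (cC := cC)
    (d := (q * (q + 1))%N)) => //.
  - exact: hadamard_tr_row'_colv.
  - apply: (tight_simplex cC (c := q.+1)) => //.
      exact: hadamard_tr_row'_parseval.
    exact: hadamard_tr_row'_sum.
  all: by rewrite ?cL ?qE /=; nia. }
have [cC jC] := affine_configuration q1 plane.
case: plane => cP cL _ _; split.
{ apply: (optimal_pairP (delta := true) (cC := cC) (d := (q ^ 2)%N)) => //.
  - exact: hadamard_row'_colv.
  - apply: (tight_parseval cC (c := q.+1)) => //.
    exact: hadamard_row'_parseval.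
  all: by rewrite ?cL ?qE /=; nia. }
have dualL : #|line (dual C)| = (q ^ 2)%N by rewrite -cP.
(* For [q = 2] the frame would have twice as many vectors as dimensions. *)
have q2 : q != 2%N.
  apply/eqP => q2; move: H hH {r Hr Hm H1 HH Hm1 HmT1}; rewrite q2.
  exact: hadamard3.
have cD := configuration_dual cC.
apply: (optimal_pairP (delta := false) (cC := cD)
  (d := (q * (q + 1))%N)) => //.
- exact: hadamard_colv.
- by apply: (tight_parseval cD (c := q.+1)).
all: by rewrite ?dualL; nia.
Qed.
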